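(* Let $s \ge 1$ be an integer, let $p \ge 2$ be an even integer, and let $A: \mathbb{R}^{s^2} \rightarrow \mathbb{R}^m$ be a linear map. Suppose that for every integer $1 \le t \le s$, \[ \Pr_{u\sim \mathrm{Unif}_t}\left( \|Au\|_p =\|u\|_p \right) \ge 0.99.\] Then $m \ge s^2/1000$.
   Context: For integers $1 \le t \le s^2$ and real $r>0$, the distribution $\mathrm{Unif}_{t,r}$ on $\mathbb{R}^{s^2}$ is defined as follows: to sample $x \sim \mathrm{Unif}_{t,r}$, first choose a subset of $t$ coordinates of $[s^2]$ uniformly at random to be the support; then the coordinates of $x$ in the support are i.i.d. mean-zero Gaussians with variance $r$, and all other coordinates are $0$. $\mathrm{Unif}_t$ denotes $\mathrm{Unif}_{t,1}$. *)

(* Defs.v *)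
From HB Require Import structures.
From mathcomp Require Import all_boot all_order all_algebra.
From mathcomp Require Import all_classical all_reals all_analysis.

Set Implicit Arguments.
Unset Strict Implicit.
Unset Printing Implicit Defensive.

Import Order.TTheory GRing.Theory Num.Theory.
Import numFieldNormedType.Exports.

Local Open Scope classical_set_scope.
Local Open Scope ring_scope.

Section tuple_cons.
Context d (T : measurableType d) (n : nat).

Definition tuple_cons (x : T * n.-tuple T) : n.+1.-tuple T :=
  [tuple of x.1 :: x.2].

Lemma measurable_tuple_cons : measurable_fun [set: T * n.-tuple T] tuple_cons.
Proof. exact: measurable_cons. Qed.

HB.instance Definition _ :=
  isMeasurableFun.Build _ _ _ _ tuple_cons measurable_tuple_cons.

End tuple_cons.

(* The product measure P_0 x ... x P_(n-1), i.e., the law of a vector with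
   independent coordinates, the i-th of which has law P_i. *)
Fixpoint tuple_prob d (T : measurableType d) (R : realType) (n : nat) :
    ('I_n -> probability T R) -> probability (n.-tuple T) R :=
  match n with
  | 0 => fun=> \d_ [tuple]
  | n'.+1 => fun P =>
      distribution (P ord0 \x tuple_prob (fun i => P (lift ord0 i)))%E
        (@tuple_cons d T n')
  end.

(* tuple_prob is characterised by its values on boxes. *)
Lemma tuple_probE d (T : measurableType d) (R : realType) (n : nat)
    (P : 'I_n -> probability T R) (B : 'I_n -> set T) :
  (forall i, measurable (B i)) ->
  tuple_prob P [set x | forall i, B i (tnth x i)] = (\prod_(i < n) P i (B i))%E.
Proof.
elim: n P B => [|n IHn] P B mB.
  rewrite big_ord0 /= diracE mem_set// => -[].
  by case.
rewrite big_ord_recl -IHn// -product_measure1E//; last first.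
  have -> : [set x | forall i, B (lift ord0 i) (tnth x i)] =
      \bigcap_(i in [set: 'I_n]) ((@tnth n T)^~ i @^-1` B (lift ord0 i)).
    by apply/seteqP; split => [x Bx i _|x Bx i]; [exact: Bx|exact: (Bx i I)].
  apply: fin_bigcap_measurable => // i _.
  by rewrite -[X in measurable X]setTI; exact: measurable_tnth.
rewrite /= /distribution /pushforward; congr (product_measure1 _ _ _).
apply/seteqP; split => -[a x] /= Bx.
  split => [|i]; first by have := Bx ord0; rewrite tnth0.
  by have := Bx (lift ord0 i); rewrite tnthS.
case: Bx => /= Ba Bx i.
by case: (unliftP ord0 i) => [j|] ->; rewrite ?tnthS ?tnth0.
Qed.

(* The law N(0, r) of one coordinate in the support; the second parameter of
   normal_prob is the standard deviation (and has to be nonzero). *)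
Definition gaussian (R : realType) (r : R) : probability (measurableTypeR R) R :=
  normal_prob 0 (Num.sqrt r).

(* The law of x ~ Unif_{t,r} conditioned on its support being S. *)
Definition supported_gaussian (R : realType) (n : nat) (r : R) (S : {set 'I_n}) :
    probability (n.-tuple (measurableTypeR R)) R :=
  tuple_prob (fun i => if i \in S then gaussian r
                       else \d_ (0 : measurableTypeR R)).

(* Unif_{t,r} on R^n: the average of the above over the t-subsets S of [n]. *)
Definition Unif (R : realType) (n t : nat) (r : R)
    (E : set (n.-tuple (measurableTypeR R))) : \bar R :=
  (('C(n, t)%:R^-1)%:E *
    \sum_(S : {set 'I_n} | #|S| == t) supported_gaussian r S E)%E.

Section Unif_measure.
Local Open Scope ereal_scope.
Context (R : realType) (n t : nat) (r : R).

Let Unif0 : Unif t r (set0 : set (n.-tuple (measurableTypeR R))) = 0.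
Proof. by rewrite /Unif big1 ?mule0// => S _; rewrite measure0. Qed.

Let Unif_ge0 (E : set (n.-tuple (measurableTypeR R))) : 0 <= Unif t r E.
Proof.
by apply: mule_ge0; [rewrite lee_fin invr_ge0|apply: sume_ge0 => S _].
Qed.

Let Unif_sigma_additive : semi_sigma_additive (@Unif R n t r).
Proof.
move=> F mF tF mUF; rewrite [X in _ --> X](_ : _ = \sum_(i <oo) Unif t r (F i)).
  by apply: is_cvg_nneseries => i _ _; exact: Unif_ge0.
rewrite /Unif nneseriesZl//; last by move=> i _; exact: sume_ge0.
congr (_ * _); rewrite nneseries_sum//.
by apply: eq_bigr => S _; rewrite measure_semi_bigcup.
Qed.

HB.instance Definition _ := isMeasure.Build _ _ _ (@Unif R n t r)
  Unif0 Unif_ge0 Unif_sigma_additive.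

Lemma Unif_setT : (t <= n)%N ->
  Unif t r [set: n.-tuple (measurableTypeR R)] = 1.
Proof.
move=> tn; rewrite /Unif.
under eq_bigr do rewrite probability_setT.
rewrite sumEFin -EFinM -big_set sumr_const card_draws card_ord.
by rewrite mulVf// pnatr_eq0 -lt0n bin_gt0.
Qed.

End Unif_measure.

Definition tuple_col (R : realType) (n : nat)
    (u : n.-tuple (measurableTypeR R)) : 'cV[R]_n :=
  \col_i tnth u i.

Definition lpnorm (R : realType) (n p : nat) (x : 'cV[R]_n) : R :=
  (\sum_(i < n) `|x i 0| ^+ p) `^ (p%:R^-1).

(* Main.v *)
Require Import Defs.
From mathcomp Require Import all_boot zify.

(** For a fixed support S, ||Au||_p^p - ||u||_p^p is a polynomial in the Gaussian
    coordinates, so either it vanishes on all of R^S (call S good) or equality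
    has probability zero. Hence at least 99% of the t-subsets are good. On a
    good S, the value at e_i and the derivative at b = 0 along e_i + b e_k show
    that the matrix h(i, k) = sum_j (A e_i)_j^(p-1) (A e_k)_j is the identity.
    Since h factors through R^m, any index set on which h is the identity has
    at most m elements.

    By the case t = 1, h(i, i) = 1 for at least 0.99 n indices, n = s^2. Join i
    and k when h(i, k) or h(k, i) is nonzero; independent sets of such indices
    have size at most m, so if m < n / 1000 a maximal matching has about n / 2
    edges. A random s-subset then contains an edge with probability well above
    1/100 (second Bonferroni inequality), although a good one contains none. *)

Set Implicit Arguments.
Unset Strict Implicit.
Unset Printing Implicit Defensive.

(** * Counting the t-subsets that contain an edge of a matching *)

(** A point lying in [X >= 1] of the sets contributes [2 X] on the left and [2 + X (X - 1)] on the
    right; the difference is [(X - 1) (X - 2) >= 0]. *)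
Lemma card_bonferroni2 (I J : finType) (F : I -> {set J}) (M : {set I}) :
  2 * \sum_(i in M) #|F i| <=
  2 * #|\bigcup_(i in M) F i| +
  \sum_(i in M) \sum_(j in M | j != i) #|F i :&: F j|.
Proof.
have cardE (A : {set J}) : #|A| = \sum_x (x \in A : nat).
  by rewrite -sum1_card big_mkcond; apply: eq_bigr => x _; case: (x \in A).
under eq_bigr do rewrite cardE.
under [in X in _ + X]eq_bigr do under eq_bigr do rewrite cardE.
rewrite exchange_big /= cardE.
under [in X in _ + X]eq_bigr do rewrite exchange_big.
rewrite [in X in _ + X]exchange_big /= !big_distrr -big_split /=.
apply: leq_sum => x _; set X := \sum_(i in M) _.
have -> : \sum_(i in M) \sum_(j in M | j != i) (x \in F i :&: F j : nat) =
    X * X.-1.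
  rewrite /X big_distrl /=; apply: eq_bigr => i iM.
  under eq_bigr do rewrite inE -mulnb.
  rewrite -big_distrr /= -/X.
  case xi: (x \in F i); last by rewrite !mul0n.
  by rewrite /X (bigD1 i iM)/= xi.
case: (boolP (x \in \bigcup_(i in M) F i)) => [_ | xNF]; first by nia.
suff -> : X = 0 by [].
apply: big1 => i iM; apply/eqP; rewrite eqb0; apply: contra xNF => xi.
by apply/bigcupP; exists i.
Qed.

(** Adding [B] is a bijection from the subsets of [~: B] of size [k - #|B|]. *)
Lemma card_supersets (T : finType) (B : {set T}) (k : nat) : #|B| <= k ->
  #|[set S : {set T} | (#|S| == k) && (B \subset S)]| =
  'C(#|T| - #|B|, k - #|B|).
Proof.
move=> Bk; have -> : #|T| - #|B| = #|~: B| by rewrite [RHS]cardsCs setCK.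
rewrite -cards_draws.
have disjP (C : {set T}) : C \subset ~: B -> C :&: B = set0.
  by rewrite subsets_disjoint setCK => /disjoint_setI0.
have setUD (C : {set T}) : C :&: B = set0 -> (C :|: B) :\: B = C.
  by move=> CB; rewrite setDUl setDv setU0 -[RHS](setID C B) CB set0U.
rewrite -[RHS](@card_in_imset _ _ (fun C => C :|: B)) => [|C D]; last first.
  rewrite !inE => /andP[/disjP CB _] /andP[/disjP DB _] CBD.
  by rewrite -(setUD C CB) CBD setUD.
apply: eq_card => S; rewrite inE.
apply/andP/imsetP => [[/eqP Sk BS]|[C]].
  exists (S :\: B).
    by rewrite inE setDE subsetIr/= -setDE cardsD (setIidPr BS) Sk.
  by rewrite -[LHS](setID S B) (setIidPr BS) setUC.
rewrite inE => /andP[/disjP CB /eqP Ck] ->.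
by rewrite subsetUr cardsU CB cards0 subn0 Ck subnK.
Qed.

(* A maximal matching: the vertices it misses are independent, hence at most m. *)
Lemma greedy_matching (T : finType) (r : rel T) (W : {set T}) (m : nat) :
  (forall U : {set T}, U \subset W ->
    {in U &, forall x y, x != y -> ~~ r x y} -> #|U| <= m) ->
  exists M : {set {set T}}, [/\ trivIset M,
    {in M, forall B, exists x y,
      [/\ x != y, r x y, B = [set x; y] & B \subset W]} &
    #|W| <= 2 * #|M| + m].
Proof.
have [n] := ubnP #|W|; elim: n W => // n IHn W Wn indep.
case: (boolP [exists x in W, exists y in W, (x != y) && r x y]); last first.
  rewrite negb_exists_in => /forall_inP Nr.
  exists set0; split; first by rewrite /trivIset /cover !big_set0 cards0.
  - by move=> B; rewrite inE.
  - rewrite cards0 muln0 add0n; apply: indep => // x y xW yW xy.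
    have := Nr x xW; rewrite negb_exists_in => /forall_inP/(_ y yW).
    by rewrite xy.
move=> /exists_inP[x xW /exists_inP[y yW /andP[xy rxy]]].
have xyW : [set x; y] \subset W by rewrite subUset !sub1set xW.
have WD : #|W| = #|W :\: [set x; y]| + 2.
  have := cardsID [set x; y] W; rewrite (setIidPr xyW) cards2 xy => <-.
  by rewrite addnC.
have [||M [tM rM cM]] := IHn (W :\: [set x; y]).
- by move: Wn; rewrite WD; lia.
- by move=> U UW; apply: indep; apply: subset_trans UW _; exact: subsetDl.
have dM : {in M, forall B : {set T}, [disjoint [set x; y] & B]}.
  move=> B /rM[_ [_ [_ _ _]]]; rewrite setDE subsetI => /andP[_].
  by rewrite subsets_disjoint setCK disjoint_sym.
have set0M : set0 \notin M.
  apply/negP => /rM[u [v [_ _ /setP/(_ u)]]].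
  by rewrite !inE eqxx.
have [tM' xyM] := trivIsetU1 dM tM set0M.
exists ([set x; y] |: M); split=> //.
- move=> B; rewrite inE => /orP[/set1P -> |/rM]; first by exists x, y.
  move=> [u [v [uv ruv Buv BW]]]; exists u, v; split=> //.
  by apply: subset_trans BW _; exact: subsetDl.
- by rewrite cardsU1 xyM WD; move: cM; lia.
Qed.

(** Bonferroni for the families of t-sets through a given edge: distinct edges are disjoint, so two
    of them span four points. [4 <= t] keeps the subtractions exact. *)
Lemma card_hit_matching (n t : nat) (T : finType) (M : {set {set T}}) :
  #|T| = n -> (4 <= t <= n)%N -> trivIset M -> {in M, forall B : {set T}, #|B| = 2} ->
  2 * (#|M| * 'C(n - 2, t - 2)) <=
  2 * #|[set S : {set T} | (#|S| == t) && [exists B in M, B \subset S]]| +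
  #|M| * (#|M|.-1 * 'C(n - 4, t - 4)).
Proof.
move=> cT /andP[t4 tn] /trivIsetP tM M2.
pose F (B : {set T}) := [set S : {set T} | (#|S| == t) && (B \subset S)].
have := card_bonferroni2 F M.
have -> : \sum_(B in M) #|F B| = #|M| * 'C(n - 2, t - 2).
  rewrite -sum_nat_const; apply: eq_bigr => B BM.
  by rewrite card_supersets M2 ?cT//; lia.
have -> : \sum_(B in M) \sum_(C in M | C != B) #|F B :&: F C| =
    #|M| * (#|M|.-1 * 'C(n - 4, t - 4)).
  rewrite -sum_nat_const; apply: eq_bigr => B BM.
  rewrite [#|M|](cardsD1 B) BM /= -sum_nat_const.
  apply: eq_big => [C|C /andP[CM CB]]; first by rewrite !inE andbC.
  have BC : #|B :|: C| = 4.
    rewrite cardsU (disjoint_setI0 (tM _ _ BM CM _)) 1?eq_sym//.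
    by rewrite cards0 !M2.
  rewrite -BC -cT -card_supersets ?BC//; apply: eq_card => S.
  by rewrite !inE subUset; case: (_ == t).
suff -> : \bigcup_(B in M) F B =
  [set S : {set T} | (#|S| == t) && [exists B in M, B \subset S]] by [].
apply/setP => S; rewrite inE; apply/bigcupP/andP => [[B BM]|[St]].
  by rewrite inE => /andP[-> BS]; split=> //; apply/exists_inP; exists B.
by move=> /exists_inP[B BM BS]; exists B; rewrite // inE St.
Qed.

From mathcomp Require Import all_boot all_order all_algebra.
From mathcomp Require Import all_classical all_reals all_analysis.
From mathcomp Require Import measurable_realfun.
From mathcomp Require Import ring lra.

Import Order.TTheory GRing.Theory Num.Theory.

Local Open Scope classical_set_scope.
Local Open Scope ring_scope.

(** * Zero sets of polynomials under product measures *)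

Lemma atomless_poly_roots (R : realType)
    (mu : probability (measurableTypeR R) R) (f : {poly R}) :
  (forall a, mu [set a] = 0%E) -> f != 0 ->
  exists N : set (measurableTypeR R),
    [/\ measurable N, mu N = 0%E & forall a, f.[a] = 0 -> N a].
Proof.
move=> mu0; have [n] := ubnP (size f); elim: n f => // n IHn f fn f0.
have [[c fc]|Nf] := pselect (exists c, root f c); last first.
  by exists set0; split=> // a fa; case: Nf; exists a; apply/rootP.
have /factor_theorem[g fE] := fc.
have g0 : g != 0 by apply: contra_neq f0 => g0; rewrite fE g0 mul0r.
have [|N [mN N0 gN]] := IHn g _ g0.
  by move: fn; rewrite fE size_Mmonic ?monicXsubC// size_XsubC addn2.
exists ([set c] `|` N); split.
- exact: measurableU.
- apply/eqP; rewrite eq_le measure_ge0 andbT.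
  apply: (@le_trans _ _ (mu [set c] + mu N)%E); first exact: measureU2.
  by rewrite mu0 N0 adde0.
- move=> a; rewrite fE hornerM hornerXsubC => /eqP.
  rewrite mulf_eq0 subr_eq0 => /orP[/eqP ga|/eqP ->]; [right|by left].
  exact: gN.
Qed.

Lemma gaussian_atom (R : realType) (r a : R) : gaussian r [set a] = 0%E.
Proof.
have /null_content_dominatesP dom := normal_prob_dominates 0 (Num.sqrt r).
by apply: dom => //; exact: lebesgue_measure_set1.
Qed.

(** Polynomiality in several variables, tested on lines: it passes to slices with a frozen
    coordinate and yields one-variable polynomials in coordinate directions. *)
Definition polynomial_on_lines (R : realType) (n : nat)
    (q : n.-tuple (measurableTypeR R) -> R) : Prop :=
  forall x y : n.-tuple R, exists f : {poly R}, forall a : R,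
    q [tuple tnth x i + a * tnth y i | i < n] = f.[a].

Lemma polynomial_on_lines_cons (R : realType) (n : nat)
    (q : n.+1.-tuple (measurableTypeR R) -> R) (a : R) :
  polynomial_on_lines q ->
  polynomial_on_lines (fun x => q (cons_tuple a x)).
Proof.
move=> q_poly x y; have [f qf] := q_poly (cons_tuple a x) (cons_tuple 0 y).
exists f => b; rewrite -qf; congr q; apply: eq_from_tnth => i.
rewrite tnth_mktuple; case: (unliftP ord0 i) => [j|] ->.
  by rewrite !tnthS tnth_mktuple.
by rewrite !tnth0 mulr0 addr0.
Qed.

(** Fubini and induction on [n], with [x] as a witness that [q] does not vanish. If the first law is
    atomless, moving the first coordinate of [x] gives a nonzero polynomial, so almost every slice
    keeps the tail of [x] as a witness. If it is a Dirac mass, the only slice that counts is the one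
    through [x]. *)
Lemma tuple_prob_zero_set (R : realType) (n : nat)
    (P : 'I_n -> probability (measurableTypeR R) R)
    (q : n.-tuple (measurableTypeR R) -> R) (x : n.-tuple R) :
  measurable_fun setT q -> polynomial_on_lines q ->
  (forall i, (forall a, P i [set a] = 0%E) \/
             P i = \d_(tnth x i : measurableTypeR R)) ->
  q x != 0 -> tuple_prob P [set u | q u = 0] = 0%E.
Proof.
elim: n P q x => [|n IHn] P q x mq q_poly P_x qx0.
  move: qx0; rewrite (tuple0 x) => /eqP q0.
  by rewrite /= diracE memNset.
have mZ : measurable [set u | q u = 0].
  have -> : [set u | q u = 0] = setT `&` q @^-1` [set 0].
    by rewrite setTI.
  exact: mq.
pose Z := @tuple_cons _ (measurableTypeR R) n @^-1` [set u | q u = 0].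
have mZ' : measurable Z.
  by rewrite -[Z]setTI; apply: measurable_tuple_cons.
pose Q := tuple_prob (fun i : 'I_n => P (lift ord0 i)).
have QE a : (Q \o xsection Z) a = Q [set u | q (cons_tuple a u) = 0].
  congr (Q _); apply/seteqP; split => u /=; rewrite /xsection/= ?inE//.
have mQ := measurable_fun_xsection Q mZ'.
have xE : x = cons_tuple (thead x) (behead_tuple x) by exact: tuple_eta.
have Q0 a : q (cons_tuple a (behead_tuple x)) != 0 -> (Q \o xsection Z) a = 0%E.
  move=> qa; rewrite QE; apply: IHn qa.
  - apply: measurableT_comp mq _.
    exact: measurable_cons.
  - exact: polynomial_on_lines_cons.
  - move=> i; have [] := P_x (lift ord0 i); [by left|move=> ->; right].
    by rewrite {1}xE tnthS.
change ((\int[P ord0]_a (Q \o xsection Z) a)%E = 0%E).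
case: (P_x ord0) => [atomless|->].
  have [f qf] := q_poly (cons_tuple 0 (behead_tuple x))
    (cons_tuple 1 (nseq_tuple n 0)).
  have {}qf a : q (cons_tuple a (behead_tuple x)) = f.[a].
    rewrite -qf; congr q; apply: eq_from_tnth => i.
    rewrite tnth_mktuple; case: (unliftP ord0 i) => [j|] ->.
      by rewrite !tnthS tnth_nseq mulr0 addr0.
    by rewrite !tnth0 mulr1 add0r.
  have f0 : f != 0.
    by apply: contra_neq qx0 => f0; rewrite xE qf f0 horner0.
  have [N [mN N0 fN]] := atomless_poly_roots atomless f0.
  rewrite (ge0_negligible_integral mN)//; apply: integral0_eq => a [_ Na].
  by apply: Q0; apply/eqP; rewrite qf => /fN.
rewrite integral_dirac// diracT mul1e; apply: Q0.
by rewrite -[tnth x ord0]/(thead x) -xE.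
Qed.

(** * The defect polynomial and its derivative at 0 *)

(** Evenness of [p] removes the absolute values, which turns equality of norms into a polynomial
    equation. *)
Lemma eq_lpnorm (R : realType) (n m p : nat) (x : 'cV[R]_n) (y : 'cV[R]_m) :
  (0 < p)%N -> ~~ odd p ->
  lpnorm p x = lpnorm p y <-> \sum_i x i 0 ^+ p = \sum_i y i 0 ^+ p.
Proof.
move=> p0 p_even; rewrite /lpnorm.
have absE k (z : 'cV[R]_k) : \sum_i `|z i 0| ^+ p = \sum_i z i 0 ^+ p.
  by apply: eq_bigr => i _; rewrite -normrX ger0_norm// exprn_even_ge0.
have sum_nneg k (z : 'cV[R]_k) : \sum_i z i 0 ^+ p \in Num.nneg.
  by rewrite nnegrE sumr_ge0// => i _; rewrite exprn_even_ge0.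
rewrite !absE; split=> [|-> //]; apply: powR_injective => //.
by rewrite invr_gt0 ltr0n.
Qed.

Lemma horner_eq0_poly (R : numDomainType) (f : {poly R}) :
  (forall a, f.[a] = 0) -> f = 0.
Proof.
move=> f0; pose rs := [seq i%:R : R | i <- iota 0 (size f)].
apply: (@roots_geq_poly_eq0 _ _ rs).
- by apply/allP => a _; apply/rootP.
- by rewrite map_inj_uniq ?iota_uniq//; apply: mulrIn; rewrite oner_eq0.
- by rewrite size_map size_iota.
Qed.

Lemma deriv_affine_exp0 (R : comNzRingType) (b c : R) (p : nat) :
  ((b%:P + c *: 'X) ^+ p)^`().[0] = b ^+ p.-1 * c *+ p.
Proof.
rewrite deriv_exp derivD derivC derivZ derivX hornerMn hornerM horner_exp.
by rewrite !hornerE mulrC.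
Qed.

Definition lp_defect (R : realType) (n m p : nat)
    (A : {linear 'cV[R]_n -> 'cV[R]_m}) (x : 'cV[R]_n) : R :=
  \sum_j A x j 0 ^+ p - \sum_i x i 0 ^+ p.

Definition lp_defect_poly (R : realType) (n m p : nat)
    (A : {linear 'cV[R]_n -> 'cV[R]_m}) (x y : 'cV[R]_n) : {poly R} :=
  \sum_j ((A x j 0)%:P + A y j 0 *: 'X) ^+ p -
  \sum_i ((x i 0)%:P + y i 0 *: 'X) ^+ p.

Lemma horner_lp_defect_poly (R : realType) (n m p : nat)
    (A : {linear 'cV[R]_n -> 'cV[R]_m}) (x y : 'cV[R]_n) (a : R) :
  (lp_defect_poly p A x y).[a] = lp_defect p A (x + a *: y).
Proof.
rewrite /lp_defect_poly /lp_defect !hornerE_comm !horner_sum linearD linearZ.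
congr (_ - _); apply: eq_bigr => i _;
  by rewrite !hornerE !mxE mulrC.
Qed.

Lemma lp_defect_poly_deriv0 (R : realType) (n m p : nat)
    (A : {linear 'cV[R]_n -> 'cV[R]_m}) (x y : 'cV[R]_n) :
  (lp_defect_poly p A x y)^`().[0] =
  (\sum_j A x j 0 ^+ p.-1 * A y j 0 - \sum_i x i 0 ^+ p.-1 * y i 0) *+ p.
Proof.
rewrite /lp_defect_poly derivB !hornerE_comm.
rewrite !(big_morph _ (@derivD R) (@deriv0 R)) !horner_sum.
by rewrite mulrnBl -!sumrMnl; congr (_ - _); apply: eq_bigr => i _;
  rewrite deriv_affine_exp0.
Qed.

Lemma measurable_lp_defect (R : realType) (n m p : nat)
    (A : {linear 'cV[R]_n -> 'cV[R]_m}) :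
  measurable_fun setT
    (fun u : n.-tuple (measurableTypeR R) => lp_defect p A (tuple_col u)).
Proof.
apply: measurable_funB; apply: measurable_sum => j; apply: measurable_funX.
  have -> : (fun v => A (tuple_col v) j 0) =
      (fun v : n.-tuple (measurableTypeR R) =>
         \sum_i tnth v i * A (delta_mx i 0) j 0).
    apply/funext => v; rewrite [tuple_col v]matrix_sum_delta.
    rewrite linear_sum summxE; apply: eq_bigr => i _.
    by rewrite big_ord1 linearZ_LR !mxE.
  apply: measurable_sum => i; apply: measurable_funM => //.
  exact: measurable_tnth.
under eq_fun do rewrite mxE.
exact: measurable_tnth.
Qed.

Lemma supported_gaussian_lp_defect (R : realType) (n m p : nat)
    (A : {linear 'cV[R]_n -> 'cV[R]_m}) (r : R) (S : {set 'I_n})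
    (x : 'cV[R]_n) :
  supported_gaussian r S [set u | lp_defect p A (tuple_col u) = 0] != 0%E ->
  (forall i, i \notin S -> x i 0 = 0) -> lp_defect p A x = 0.
Proof.
move=> good xS; apply: contra_neq_eq good => qx0.
pose u : n.-tuple R := [tuple x i 0 | i < n].
have uE : tuple_col u = x.
  by apply/colP => i; rewrite mxE tnth_mktuple.
apply: (@tuple_prob_zero_set _ _ _ (fun u => lp_defect p A (tuple_col u)) u).
- exact: measurable_lp_defect.
- move=> v w; exists (lp_defect_poly p A (tuple_col v) (tuple_col w)) => a.
  rewrite horner_lp_defect_poly; congr (lp_defect _ _ _).
  by apply/colP => i; rewrite !mxE tnth_mktuple.
- move=> i; case: ifPn => [_|iS]; [left=> a; exact: gaussian_atom|right].
  by rewrite tnth_mktuple xS.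
- by rewrite uE.
Qed.

(* Up to the factor p, the derivative of ||A (e_i + b e_k)||_p^p at b = 0. Only
   this coefficient is needed, so p = 2 and p > 2 need not be distinguished. *)
Definition semi_gram (R : realType) (n m p : nat)
    (A : {linear 'cV[R]_n -> 'cV[R]_m}) (i k : 'I_n) : R :=
  \sum_j A (delta_mx i 0) j 0 ^+ p.-1 * A (delta_mx k 0) j 0.

Lemma semi_gram_id (R : realType) (n m p : nat)
    (A : {linear 'cV[R]_n -> 'cV[R]_m}) (S : {set 'I_n}) : (1 < p)%N ->
  (forall x : 'cV[R]_n, (forall i, i \notin S -> x i 0 = 0) ->
    lp_defect p A x = 0) ->
  {in S &, forall i k, semi_gram p A i k = (i == k)%:R}.
Proof.
move=> p1 vanish i k iS kS.
have f0 : lp_defect_poly p A (delta_mx i 0) (delta_mx k 0) = 0.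
  apply: horner_eq0_poly => a; rewrite horner_lp_defect_poly vanish// => l lS.
  rewrite !mxE !eqxx !andbT.
  have /negPf -> : l != i by apply: contraNneq lS => ->.
  have /negPf -> : l != k by apply: contraNneq lS => ->.
  by rewrite mulr0 addr0.
have /eqP := lp_defect_poly_deriv0 p A (delta_mx i 0) (delta_mx k 0).
rewrite f0 deriv0 horner0 eq_sym mulrn_eq0 eqn0Ngt (ltn_trans _ p1)//= subr_eq0.
rewrite -/(semi_gram p A i k) => /eqP ->.
rewrite (bigD1 i)//= big1 => [|l li]; rewrite !mxE !eqxx ?andbT ?(negPf li).
  by rewrite expr1n mul1r addr0.
(* Off the diagonal the factor [0 ^+ p.-1] vanishes because [p.-1 > 0]. *)
by case: (p) p1 => [|[|p']]// _; rewrite exprS !mul0r.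
Qed.

Lemma semi_gram_rank (R : realType) (n m p : nat)
    (A : {linear 'cV[R]_n -> 'cV[R]_m}) (U : {set 'I_n}) :
  {in U &, forall i k, semi_gram p A i k = (i == k)%:R} -> (#|U| <= m)%N.
Proof.
move=> hU.
apply: (@mulmx1_min R _ _
  (\matrix_(a < #|U|, j < m) A (delta_mx (enum_val a) 0) j 0 ^+ p.-1)
  (\matrix_(j < m, b < #|U|) A (delta_mx (enum_val b) 0) j 0)).
apply/matrixP => a b; rewrite !mxE -(inj_eq enum_val_inj).
rewrite -hU ?enum_valP//; apply: eq_bigr => j _; by rewrite !mxE.
Qed.

(** * From probabilities to counts of supports, and the final contradiction *)

(** A support of nonzero probability contributes at most 1, any other contributes 0. *)
Lemma Unif_le_card (R : realType) (n t : nat) (r : R)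
    (E : set (n.-tuple (measurableTypeR R))) : measurable E ->
  (Unif t r E <= ('C(n, t)%:R^-1 *
    #|[set S : {set 'I_n} | (#|S| == t) && (supported_gaussian r S E != 0%E)]%SET|%:R)%:E)%E.
Proof.
move=> mE; rewrite EFinM; apply: lee_wpmul2l; first by rewrite lee_fin invr_ge0.
rewrite -sum1_card natr_sum -sumEFin.
rewrite [leLHS]big_mkcond [leRHS]big_mkcond /=; apply: lee_sum => S _.
rewrite finset.inE; case: (_ == t) => //=.
by case: eqVneq => [->//|_]; exact: probability_le1.
Qed.

(* With X = n + s = s (s + 1), the binomial ratios are 'C(n-2, s-2) / 'C(n, s) =
   1 / X and 'C(n-4, s-4) / 'C(n, s) <= 1 / X ^ 2, so x = k / X <= 1 / 2 satisfies
   2 x <= 1 / 50 + x ^ 2. *)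
Lemma matching_density_le (R : realType) (n s k b : nat) : n = (s ^ 2)%N ->
  (4 <= s)%N -> (2 * k <= n)%N -> b%:R <= 'C(n, s)%:R / 100%:R :> R ->
  (2 * (k * 'C(n - 2, s - 2)) <= 2 * b + k * (k.-1 * 'C(n - 4, s - 4)))%N ->
  k%:R <= (n%:R + s%:R) / 50%:R :> R.
Proof.
move=> nE s4 kn bC H.
set N := 'C(n, s) in bC; set N2 := 'C(n - 2, s - 2) in H.
set N4 := 'C(n - 4, s - 4) in H.
have n16 : (4 * 4 <= n)%N by rewrite nE leq_mul.
have [N2E N4E] : (n * n.-1 * N2 = s * s.-1 * N /\
    n.-2 * n.-2.-1 * N4 = s.-2 * s.-2.-1 * N2)%N.
  rewrite /N /N2 /N4.
  have [n' ->] : exists n', n = n'.+4 by exists (n - 4)%N; clear -n16; lia.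
  have [s' ->] : exists s', s = s'.+4 by exists (s - 4)%N; clear -s4; lia.
  rewrite !subSS !subn0 /=.
  have := mul_bin_diag n'.+1 s'; have := mul_bin_diag n'.+2 s'.+1.
  have := mul_bin_diag n'.+3 s'.+2; have := mul_bin_diag n'.+4 s'.+3.
  move=> /= h1 h2 h3 h4; split.
    by rewrite -mulnA h2 mulnCA h1 mulnA [(s'.+3 * _)%N]mulnC.
  by rewrite -mulnA h4 mulnCA h3 mulnA [(s'.+1 * _)%N]mulnC.
(* As [n = s^2], [n (n - 1) = s (s - 1) (n + s)]. *)
have {}N2E : ((n + s) * N2 = N)%N.
  have ss0 : (0 < s * s.-1)%N by rewrite muln_gt0; clear -s4; lia.
  apply/eqP; rewrite -(eqn_pmul2l ss0) -N2E [eqbLHS]mulnA; apply/eqP.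
  congr (_ * N2)%N; rewrite nE; have [q ->] : exists q, s = q.+1.
    by exists s.-1; rewrite prednK//; clear -s4; lia.
  have -> : ((q.+1 ^ 2).-1 = q * q.+2)%N by rewrite expnS expn1; lia.
  by rewrite /=; ring.
(* Here [n + s = s (s + 1)], with [s (s - 2) <= n - 2] and [(s + 1) (s - 3) <= n - 3]. *)
have {}N4E : ((n + s) * N4 <= N2)%N.
  have nn0 : (0 < n.-2 * n.-2.-1)%N by rewrite muln_gt0; clear -n16; lia.
  rewrite -(leq_pmul2l nn0) mulnCA N4E [leqLHS]mulnA leq_mul2r; apply/orP; right.
  rewrite nE; have [q ->] : exists q, s = q.+4.
    by exists (s - 4)%N; clear -s4; lia.
  have -> : (q.+4 ^ 2 = (q * q + 8 * q + 13).+3)%N by lia.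
  by rewrite /=; lia.
(* Multiply by [(n + s)^2] to eliminate [N2] and [N4]. *)
have {}H : (2 * (k * (n + s)) * N <= 2 * b * (n + s) ^ 2 + k ^ 2 * N)%N.
  rewrite -N2E; move: N2E N4E H; clear => _ N4E H.
  have h1 : (k * (k.-1 * N4) <= k ^ 2 * N4)%N.
    by rewrite mulnA leq_mul2r leq_mul2l leq_pred !orbT.
  have h2 : (k ^ 2 * (n + s) * ((n + s) * N4) <= k ^ 2 * (n + s) * N2)%N.
    by rewrite leq_mul2l N4E orbT.
  have := leq_mul (leq_trans H (leq_add (leqnn _) h1)) (leqnn ((n + s) ^ 2)).
  lia.
have N0 : (0 < N)%N.
  by rewrite bin_gt0 nE -{1}[s]expn1 leq_exp2l//; clear -s4; lia.
move: H; rewrite -(ler_nat R) !(natrD, natrM, natrX).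
set X := n%:R + s%:R => H.
have k0 : 0 <= k%:R :> R by [].
have X0 : 0 < X.
  by rewrite /X -natrD ltr0n; clear -s4; lia.
have kX : 2%:R * k%:R <= X.
  by rewrite /X -natrM -natrD ler_nat; clear -kn; lia.
have {}N0 : 0 < N%:R :> R by rewrite ltr0n.
have {}H : 2 * (k%:R * X) <= X ^+ 2 / 50 + k%:R ^+ 2.
  rewrite -(ler_pM2r N0); apply: le_trans H _.
  rewrite [leRHS]mulrDl lerD2r.
  have X2 : 0 <= X ^+ 2 by exact: sqr_ge0.
  have := ler_wpM2r X2 bC; lra.
(* [2 k <= X] gives [k^2 <= k X / 2], which excludes the large solutions of the quadratic
   inequality: [3/2 k X <= X^2 / 50]. *)
have kk := ler_wpM2l k0 kX; rewrite -(ler_pM2r X0).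
clearbody X; move: (k%:R : R) H k0 kX kk => K H k0 kX kk; clear -H kk X0; nra.
Qed.

Theorem mainTheorem1 (R : realType) (s p m : nat)
    (A : {linear 'cV[R]_(s ^ 2) -> 'cV[R]_m}) :
  (1 <= s)%N -> (2 <= p)%N -> ~~ odd p ->
  (forall t : nat, (1 <= t <= s)%N ->
    ((99%:R / 100%:R)%:E <=
     Unif t 1 [set u | lpnorm p (A (tuple_col u)) = lpnorm p (tuple_col u)])%E) ->
  (s ^ 2)%:R / 1000%:R <= m%:R :> R.
Proof.
move=> s1 p2 p_even.
have p0 : (0 < p)%N by exact: ltnW.
set E := [set u | _].
have {E}-> : E = [set u | lp_defect p A (tuple_col u) = 0].
  apply/seteqP; split => u /=; rewrite /E/= eq_lpnorm// /lp_defect.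
    by move=> ->; rewrite subrr.
  by move/eqP; rewrite subr_eq0 => /eqP.
set E := [set u | _].
have mE : measurable E.
  have mA := measurable_lp_defect p A.
  rewrite (_ : E = setT `&`
    (fun u => lp_defect p A (tuple_col u)) @^-1` [set 0]) ?setTI//.
  by rewrite -[_ @^-1` _]setTI; exact: mA.
have [n nE] : exists n, n = (s ^ 2)%N by exists (s ^ 2)%N.
rewrite -nE in A E mE *.
set good := fun S : {set 'I_n} => supported_gaussian 1 S E != 0%E.
move=> hE.
have good_id S : good S ->
    {in S &, forall i k, semi_gram p A i k = (i == k)%:R}.
  move=> gS; apply: semi_gram_id => // x. exact: supported_gaussian_lp_defect gS.
have card_good t : (1 <= t <= s)%N -> 99%:R / 100%:R * 'C(n, t)%:R <=
    #|[set S : {set 'I_n} | (#|S| == t) && good S]%SET|%:R :> R.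
  move=> ts; have := le_trans (hE t ts) (Unif_le_card t 1 mE).
  rewrite lee_fin ler_pdivlMl ?ltr0n ?bin_gt0 1?mulrC//.
  by rewrite nE; clear -ts; nia.
pose W := [set i : 'I_n | semi_gram p A i i == 1]%SET.
have cardW : 99%:R / 100%:R * n%:R <= #|W|%:R :> R.
  have := card_good 1%N; rewrite s1 bin1 => /(_ isT) /le_trans; apply.
  rewrite ler_nat -[leqRHS](card_imset _ (@set1_inj _)); apply: subset_leq_card.
  apply/fintype.subsetP => S; rewrite finset.inE => /andP[/cards1P[i ->] gS].
  apply: imset_f; rewrite finset.inE (good_id _ gS) ?eqxx//; exact: set11.
(* [semi_gram] need not be symmetric, so a non-edge has to make both entries vanish. *)
pose r (i k : 'I_n) :=
  (semi_gram p A i k != 0) || (semi_gram p A k i != 0).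
have indep (U : {set 'I_n}) : U \subset W ->
    {in U &, forall i k, i != k -> ~~ r i k} -> (#|U| <= m)%N.
  move=> /fintype.subsetP UW Ur; apply: (@semi_gram_rank _ _ _ p A) => i k iU kU.
  case: eqVneq => [<-|ik]; first by have := UW i iU; rewrite finset.inE => /eqP.
  by have := Ur i k iU kU ik; rewrite negb_or negbK => /andP[/eqP].
have [M [tM rM WM]] := greedy_matching indep.
have M2 : {in M, forall B : {set 'I_n}, #|B| = 2%N}.
  by move=> B /rM[i [k [ik _ -> _]]]; rewrite cards2 ik.
rewrite leNgt; apply/negP => mn.
have n0 : (0 < n)%N by rewrite nE expn_gt0 s1.
(* A single index of [W] is an independent set. Hence [n > 1000], which forces [4 <= s]. *)
have m0 : (0 < m)%N.
  have [W0|[i iW]] := set_0Vmem W.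
    move: cardW; rewrite W0 cards0 leNgt => /negP[].
    by rewrite mulr_gt0 ?divr_gt0 ?ltr0n.
  rewrite -(cards1 i); apply: indep; first by rewrite finset.sub1set.
  by move=> j k /finset.set1P -> /finset.set1P ->; rewrite eqxx.
have mn' : (1000 * m < n)%N.
  by rewrite -(ltr_nat R) natrM mulrC -ltr_pdivlMr ?ltr0n.
have s4 : (4 <= s)%N.
  rewrite leqNgt; apply/negP => s3.
  have : (n <= 3 ^ 2)%N by rewrite nE leq_exp2r.
  by clear -m0 mn'; lia.
have kn : (2 * #|M| <= n)%N.
  rewrite mulnC -sum_nat_const -(eq_bigr _ M2) (eqP tM) -[leqRHS]card_ord.
  exact: max_card.
have sn : (s <= n)%N by rewrite nE -{1}[s]expn1 leq_exp2l// (leq_trans _ s4).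
have hit := card_hit_matching (card_ord n) _ tM M2.
have {}hit := hit s; rewrite s4 sn in hit; have {}hit := hit isT.
set b := #|[set S : {set 'I_n} | _]%SET| in hit.
(* [semi_gram] is the identity on a good set, so such a set contains no edge; the [b] sets that do
   are among the at most 1% bad ones. *)
have bC : b%:R <= 'C(n, s)%:R / 100%:R :> R.
  have := card_good s; rewrite s1 leqnn => /(_ isT).
  set g := #|_| => Cg.
  suff : (b + g <= 'C(n, s))%N.
    by rewrite -(ler_nat R) natrD; lra.
  rewrite -[X in 'C(X, _)]card_ord -card_draws -cardsUI.
  rewrite (_ : _ :&: _ = finset.set0)%SET.
    rewrite cards0 addn0; apply: subset_leq_card; apply/fintype.subsetP => S.
    by rewrite !finset.inE -andb_orr => /andP[].
  apply/setP => S; rewrite !finset.inE; apply/negP.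
  move=> /andP[/andP[_ /exists_inP[B /rM[i [k [ik rik -> _]]]]]].
  rewrite finset.subUset !finset.sub1set => /andP[iS kS] /andP[_ gS].
  move: rik; rewrite /r !(good_id _ gS)// [k == i]eq_sym (negPf ik).
  by rewrite eqxx.
(* With [s <= n / 4], [#|M| <= n / 40], so [0.99 n <= #|W| <= 2 #|M| + m < n / 20 + n / 1000], a
   contradiction. *)
have := matching_density_le nE s4 kn bC hit.
have : s%:R <= n%:R / 4%:R :> R.
  rewrite ler_pdivlMr ?ltr0n// -natrM ler_nat nE.
  by rewrite expnS expn1 leq_mul2l s4 orbT.
have : #|W|%:R <= 2%:R * #|M|%:R + m%:R :> R.
  by rewrite -natrM -natrD ler_nat.
have : 0 < n%:R :> R by rewrite ltr0n.
lra.
Qed.
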